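(* Let $R$ be a ring and $M$ an $R$-module. The following are equivalent: (a) the ring extension $R\subseteq R(+)M$ has FCP; (b) $M$ has finite length as an $R$-module, i.e. $\mathrm{L}_R(M)<\infty$; (c) $R/(0:M)$ is Artinian and $M$ is a finitely generated $R$-module.
   Context: All rings considered are commutative and unital, and $R$ is nonzero. $R(+)M$ is the idealization of $M$: the set $R\times M$ with operations $(r,m)+(s,n)=(r+s,m+n)$ and $(r,m)(s,n)=(rs,rn+sm)$; $R$ is identified with a subring via $r\mapsto(r,0)$. $(0:M)$ is the annihilator of $M$ in $R$. For a ring extension $R\subseteq S$, $[R,S]$ is the set of all $R$-subalgebras of $S$; the extension has FCP if every chain (with respect to inclusion) of elements of $[R,S]$ is finite. *)

(* Defs.v *)
From HB Require Import structures.
From mathcomp Require Export all_boot all_order all_algebra.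
From mathcomp Require Export boolp classical_sets functions cardinality.
From mathcomp Require Export constructive_ereal.

Set Implicit Arguments.
Unset Strict Implicit.
Unset Printing Implicit Defensive.

Import Order.TTheory GRing.Theory Num.Theory.
Local Open Scope classical_set_scope.
Local Open Scope ring_scope.

Section Modules.
Variables (R : pzRingType) (M : lmodType R).

Definition submodules : set (set M) := [set N | GRing.submod_closed (mem N)].

Definition finitely_generated : Prop :=
  exists (n : nat) (g : 'I_n -> M),
    forall m : M, exists c : 'I_n -> R, m = \sum_(i < n) c i *: g i.

(* There are submodules N 0 < N 1 < ... < N n; the values of N beyond n are
   irrelevant. *)
Definition has_submodule_chain (n : nat) : Prop :=
  exists N : nat -> set M,
    (forall i, (i <= n)%N -> submodules (N i)) /\
    (forall i, (i < n)%N -> N i `<` N i.+1).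

Definition chain_lengths : set (\bar int) :=
  [set (n%:Z)%:E | n in has_submodule_chain].

(* The supremum of the lengths of the chains of submodules, in Z extended with
   +oo; [supremum] takes a default value, which is never used here by
   [module_length_isLub] below. *)
Definition module_length : \bar int := supremum 0%E chain_lengths.

Lemma submodules0 : submodules [set 0].
Proof.
split; first by rewrite inE.
by move=> a u v; rewrite !inE => -> ->; rewrite scaler0 addr0.
Qed.

Lemma chain_lengths0 : chain_lengths 0%:Z%:E.
Proof.
exists 0%N => //.
by exists (fun=> [set 0]); split=> // i _; exact: submodules0.
Qed.

Lemma module_length_isLub : isLub chain_lengths module_length.
Proof.
have [x [ubx lubx]] : supremums chain_lengths !=set0.
  case: (pselect (ubound has_submodule_chain !=set0)) => [|nub].
    move=> /nat_supremums_neq0[s [ubs lubs]]; exists (s%:Z)%:E; split.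
      by move=> _ [n Hn <-]; rewrite lee_fin lez_nat; exact: ubs.
    move=> [[y|y]||] uby; have := uby _ chain_lengths0; rewrite // => _.
    rewrite lee_fin lez_nat; apply: lubs => n Hn.
    by have := uby _ (ex_intro2 _ _ n Hn erefl); rewrite lee_fin lez_nat.
  exists +oo%E; split; first by move=> y _; rewrite leey.
  move=> [[y|y]||] uby; have := uby _ chain_lengths0; rewrite // => _.
  case: nub; exists y => n Hn.
  by have := uby _ (ex_intro2 _ _ n Hn erefl); rewrite lee_fin lez_nat.
rewrite /module_length /supremum ifF; last first.
  by apply/negbTE/set0P; exists 0%:Z%:E; exact: chain_lengths0.
case: xgetP => [y _ [uby luby]|nx]; first by split.
by exfalso; apply: (nx x); split.
Qed.

Definition artinian_module : Prop :=
  forall N : nat -> set M,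
    (forall n, submodules (N n)) -> (forall n, N n.+1 `<=` N n) ->
    exists n, forall m, (n <= m)%N -> N m = N n.

End Modules.

Arguments submodules {R} M.
Arguments finitely_generated {R} M.
Arguments has_submodule_chain {R} M.
Arguments chain_lengths {R} M.
Arguments module_length {R} M.
Arguments artinian_module {R} M.

(* The submodules of A^o are the ideals of A. *)
Definition artinian_ring (A : comPzRingType) : Prop := artinian_module A^o.

Section Extensions.
Variables (R : comNzRingType) (S : comAlgType R).

Definition intermediate_algebras : set (set S) :=
  [set A | GRing.subalg_closed (mem A)].

Definition FCP : Prop :=
  forall C : set (set S), C `<=` intermediate_algebras ->
    total_on C subset -> finite_set C.

End Extensions.

Arguments intermediate_algebras {R} S.
Arguments FCP {R} S.

Section Idealization.
Variables (R : comNzRingType) (M : lmodType R).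

Definition idealization : Type := (R * M)%type.

HB.instance Definition _ := GRing.Zmodule.on idealization.

Definition idealization_one : idealization := (1, 0).

Definition idealization_mul (x y : idealization) : idealization :=
  (x.1 * y.1, x.1 *: y.2 + y.1 *: x.2).

Definition idealization_scale (a : R) (x : idealization) : idealization :=
  (a * x.1, a *: x.2).

Fact idealization_mulA : associative idealization_mul.
Proof.
move=> [r m] [s n] [t p]; congr pair => /=; first exact: mulrA.
by rewrite !scalerDr !scalerA addrA (mulrC s t) [t * r]mulrC (mulrC t s).
Qed.

Fact idealization_mulC : commutative idealization_mul.
Proof.
by move=> [r m] [s n]; congr pair; rewrite /= ?(mulrC r) // addrC.
Qed.

Fact idealization_mul1 : left_id idealization_one idealization_mul.
Proof. by case=> r m; rewrite /idealization_mul /= mul1r scale1r scaler0 addr0. Qed.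

Fact idealization_mulDl : left_distributive idealization_mul +%R.
Proof.
move=> [r m] [s n] [t p]; congr pair => /=; first exact: mulrDl.
by rewrite scalerDl scalerDr addrACA.
Qed.

Fact idealization_1neq0 : idealization_one != 0.
Proof. by apply/eqP => -[/eqP]; rewrite oner_eq0. Qed.

HB.instance Definition _ := GRing.Zmodule_isComNzRing.Build idealization
  idealization_mulA idealization_mulC idealization_mul1 idealization_mulDl
  idealization_1neq0.

Fact idealization_scaleA a b x :
  idealization_scale a (idealization_scale b x) = idealization_scale (a * b) x.
Proof. by case: x => r m; congr pair; rewrite /= ?mulrA ?scalerA. Qed.

Fact idealization_scale1 : left_id 1 idealization_scale.
Proof. by case=> r m; rewrite /idealization_scale /= mul1r scale1r. Qed.

Fact idealization_scaleDr : right_distributive idealization_scale +%R.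
Proof. by move=> a [r m] [s n]; congr pair; rewrite /= ?mulrDr ?scalerDr. Qed.

Fact idealization_scaleDl x :
  {morph idealization_scale^~ x : a b / a + b}.
Proof. by move=> a b; congr pair; rewrite /= ?mulrDl ?scalerDl. Qed.

HB.instance Definition _ := GRing.Zmodule_isLmodule.Build R idealization
  idealization_scaleA idealization_scale1 idealization_scaleDr
  idealization_scaleDl.

Fact idealization_scaleAl (a : R) (x y : idealization) :
  a *: (x * y) = (a *: x) * y.
Proof.
case: x y => [r m] [s n]; congr pair => /=; first exact: mulrA.
by rewrite scalerDr !scalerA (mulrC s).
Qed.

HB.instance Definition _ :=
  GRing.Lmodule_isLalgebra.Build R idealization idealization_scaleAl.
HB.instance Definition _ := GRing.Lalgebra_isComAlgebra.Build R idealization.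

(* The structure map of the algebra is the embedding r |-> (r, 0) that makes R
   a subring of the idealization. *)
Lemma idealization_in_alg (r : R) : r%:A = (r, 0) :> idealization.
Proof. by congr pair; rewrite /= ?mulr1 ?scaler0. Qed.

Lemma idealization_in_alg_inj : injective (in_alg idealization).
Proof. by move=> r s; rewrite !in_algE !idealization_in_alg => -[]. Qed.

End Idealization.

Arguments idealization {R} M.

Section Annihilator.
Variables (R : comNzRingType) (M : lmodType R).

Definition annihilator : {pred R} := fun r => `[< forall m : M, r *: m = 0 >].

Fact annihilator_zmod_closed : GRing.zmod_closed annihilator.
Proof.
split=> [|r s /asboolP r0 /asboolP s0]; apply/asboolP => m.
- exact: scale0r.
- by rewrite scalerBl r0 s0 subrr.
Qed.

HB.instance Definition _ :=
  GRing.isZmodClosed.Build R annihilator annihilator_zmod_closed.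

Lemma annihilatorMl (a r : R) : r \in annihilator -> a * r \in annihilator.
Proof. by move=> /asboolP r0; apply/asboolP => m; rewrite -scalerA r0 scaler0. Qed.

(* The library endows {ideal_quot I} with a ring structure only when I is a
   proper ideal, which the annihilator of the zero module is not. Here it is
   made a possibly zero ring. *)
Definition ann_quot : Type := {ideal_quot annihilator}.

HB.instance Definition _ := GRing.Zmodule.on ann_quot.
HB.instance Definition _ : EqQuotient R (Quotient.equiv annihilator) ann_quot :=
  EqQuotient.on ann_quot.

Local Open Scope quotient_scope.

Definition ann_quot_one : ann_quot := \pi_ann_quot 1.

Definition ann_quot_mul : ann_quot -> ann_quot -> ann_quot :=
  lift_op2 ann_quot *%R.

Lemma ann_quot_eqE (r s : R) :
  (\pi_ann_quot r == \pi_ann_quot s) = (r - s \in annihilator).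
Proof. exact/esym/(Quotient.idealrBE annihilator). Qed.

Lemma pi_ann_quot_add : {morph \pi_ann_quot : r s / r + s}.
Proof. by move=> r s; exact: (Quotient.pi_add annihilator). Qed.

Lemma pi_ann_quot_mul (r s : R) :
  \pi_ann_quot (r * s) = ann_quot_mul (\pi_ann_quot r) (\pi_ann_quot s).
Proof.
unlock ann_quot_mul; apply/eqP; rewrite ann_quot_eqE.
have repr_ann (t : R) : t - repr (\pi_ann_quot t) \in annihilator.
  by rewrite -ann_quot_eqE reprK.
rewrite -[r * s](subrK (r * repr (\pi_ann_quot s))) -mulrBr -addrA -mulrBl.
apply: rpredD; first exact/annihilatorMl/repr_ann.
by rewrite mulrC; exact/annihilatorMl/repr_ann.
Qed.

Fact ann_quot_mulA : associative ann_quot_mul.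
Proof.
move=> x y z; rewrite -[x]reprK -[y]reprK -[z]reprK.
by rewrite -!pi_ann_quot_mul mulrA.
Qed.

Fact ann_quot_mulC : commutative ann_quot_mul.
Proof.
move=> x y; rewrite -[x]reprK -[y]reprK.
by rewrite -!pi_ann_quot_mul mulrC.
Qed.

Fact ann_quot_mul1 : left_id ann_quot_one ann_quot_mul.
Proof. by move=> x; rewrite -[x]reprK -pi_ann_quot_mul mul1r. Qed.

Fact ann_quot_mulDl : left_distributive ann_quot_mul +%R.
Proof.
move=> x y z; rewrite -[x]reprK -[y]reprK -[z]reprK.
by rewrite -pi_ann_quot_add -!pi_ann_quot_mul -pi_ann_quot_add mulrDl.
Qed.

HB.instance Definition _ := GRing.Zmodule_isComPzRing.Build ann_quot
  ann_quot_mulA ann_quot_mulC ann_quot_mul1 ann_quot_mulDl.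

Lemma pi_ann_quot_monoid_morphism : monoid_morphism \pi_ann_quot.
Proof. by split=> // r s; exact: pi_ann_quot_mul. Qed.

End Annihilator.

Arguments annihilator {R} M.
Arguments ann_quot {R} M.

(* Main.v *)
Require Import Defs.

(** The subalgebras of the idealization that contain R are exactly the sets
    R x N with N a submodule of M, since such an algebra contains (r, m) if and
    only if it contains (0, m). So FCP says that every chain of submodules of M
    is finite, and the whole theorem is about the lattice of submodules. Each
    of the three conditions is compared with a fourth one: there is a finite
    series of submodules from 0 to M each of whose steps is simple or trivial
    ([finite_length]).

    From a series to chains: send a submodule N to the number of steps P, Q of
    the series for which N meets the difference of Q and P. This number is
    bounded by the number of steps and it increases strictly with N
    ([finite_length_rank]). It therefore bounds the length of every chain of
    submodules, so the length is finite, and it is injective on every chain,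
    which gives FCP. No comparison of two composition series is involved.

    From chains to a series: if the extension has FCP or M finite length, the
    submodules satisfy both chain conditions. By the descending one, every
    proper submodule has a minimal submodule above it, and by the ascending one
    the series built by adding such covers stops ([acc_dcc_finite_length]).

    From a series to generators and an Artinian quotient: every step of the
    series costs at most one generator of M. If s generates M, then (0 : M) is
    the intersection of the kernels of the maps r |-> r g from R to M, for g in
    s, and pulling the series of M back along these maps gives a series from
    (0 : M) to R.

    From generators and an Artinian quotient to a series: if R satisfies the
    descending chain condition above an ideal J, here J = (0 : M), then there
    is a series from J to R ([artinian_finite_length], the theorem of Hopkins,
    Levitzki and Akizuki). Its images under the maps r |-> r g, for g in a
    finite generating family, give a series from 0 to M. The usual proof of
    that theorem shows that the Jacobson radical is nilpotent and that there
    are finitely many maximal ideals. Both are replaced here by two choices of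
    minimal elements.

    Let I be a minimal ideal above J from which there is a series to R. Vector
    spaces with the descending chain condition have finite dimension, so there
    is also a series from mI + J to R, and mI + J = I for every maximal ideal
    m. If I were not J, let K be minimal above J with KI not contained in J.
    Then K = Rx + J for some x, and mK + J = K for every maximal ideal m,
    because mKI + J = K(mI) + J. Hence for each m some a in m satisfies
    (1 - a) x in J, which is absurd when m contains (J : x). *)

Set Implicit Arguments.
Unset Strict Implicit.
Unset Printing Implicit Defensive.

Import Order.TTheory GRing.Theory Num.Theory.
Local Open Scope classical_set_scope.
Local Open Scope ring_scope.

(** * Chain conditions *)

Section ChainConditions.
Variable T : Type.

Definition no_sequence (r : T -> T -> Prop) (F : set T) :=
  ~ exists f : nat -> T, forall n, F (f n) /\ r (f n) (f n.+1).

Lemma no_sequence_sub r (F G : set T) :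
  G `<=` F -> no_sequence r F -> no_sequence r G.
Proof.
move=> GF nF [f fP]; apply: nF; exists f => n.
by have [/GF Ff rf] := fP n.
Qed.

(** Dependent choice: without such an element, a sequence could be continued
    forever inside [F].  Inclusion and its converse give the maximal and the
    minimal elements that the chain conditions provide. *)
Lemma no_sequence_extremal r (F : set T) :
  no_sequence r F -> F !=set0 ->
  exists2 x, F x & forall y, F y -> ~ r x y.
Proof.
move=> nF [x0 Fx0]; apply: contrapT => nx; apply: nF.
have next (x : {x | F x}) : {y : {x | F x} | r (sval x) (sval y)}.
  case: x => x Fx; apply: cid; apply: contrapT => ny; apply: nx.
  by exists x => // y Fy rxy; apply: ny; exists (exist _ y Fy).
pose f n := iter n (fun x => sval (next x)) (exist _ x0 Fx0).
exists (fun n => sval (f n)) => n; split; first exact: svalP (f n).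
exact: svalP (next (f n)).
Qed.

End ChainConditions.

Definition dcc T (F : set (set T)) := no_sequence (fun A B => B `<` A) F.
Definition acc T (F : set (set T)) := no_sequence (fun A B => A `<` B) F.

(** * Submodules and linear maps *)

Section Submodules.
Variables (R : pzRingType) (X : lmodType R).
Implicit Types (N P Q K : set X) (x y : X).

Lemma submodulesP N :
  submodules X N <-> N 0 /\ forall a x y, N x -> N y -> N (a *: x + y).
Proof.
rewrite /submodules /= /GRing.submod_closed inE; split=> -[N0 Nlin]; split=> //.
  by move=> a x y /mem_set Nx /mem_set Ny; apply/set_mem/Nlin.
by move=> a x y /set_mem Nx /set_mem Ny; apply/mem_set/Nlin.
Qed.

Lemma submod0 N : submodules X N -> N 0.
Proof. by move=> /submodulesP[]. Qed.

Lemma submod_lin N a x y : submodules X N -> N x -> N y -> N (a *: x + y).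
Proof. by move=> /submodulesP[_]; apply. Qed.

Lemma submodD N x y : submodules X N -> N x -> N y -> N (x + y).
Proof. by move=> sN Nx Ny; rewrite -[x]scale1r; exact: submod_lin. Qed.

Lemma submodZ N a x : submodules X N -> N x -> N (a *: x).
Proof.
by move=> sN Nx; rewrite -[_ *: x]addr0; apply: submod_lin => //;
  exact: submod0.
Qed.

Lemma submodB N x y : submodules X N -> N x -> N y -> N (x - y).
Proof. by move=> sN Nx Ny; rewrite addrC -scaleN1r; exact: submod_lin. Qed.

Lemma submodulesT : submodules X setT.
Proof. exact/submodulesP. Qed.

Lemma submodulesI N P :
  submodules X N -> submodules X P -> submodules X (N `&` P).
Proof.
move=> sN sP; apply/submodulesP; split; first by split; exact: submod0.
by move=> a x y [Nx Px] [Ny Py]; split; exact: submod_lin.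
Qed.

Definition submod_gen (G : set X) : set X :=
  [set x | forall N, submodules X N -> G `<=` N -> N x].

Lemma submod_gen_submodule G : submodules X (submod_gen G).
Proof.
apply/submodulesP; split; first by move=> N sN _; exact: submod0.
by move=> a x y Gx Gy N sN GN; apply: submod_lin => //; [exact: Gx|exact: Gy].
Qed.

Lemma sub_submod_gen G : G `<=` submod_gen G.
Proof. by move=> x Gx N _; exact. Qed.

Lemma submod_gen_sub G N : submodules X N -> G `<=` N -> submod_gen G `<=` N.
Proof. by move=> sN GN x; exact. Qed.

Definition above N : set (set X) := [set P | submodules X P /\ N `<=` P].

End Submodules.

Section LinearMaps.
Variables (R : pzRingType) (X Y : lmodType R) (phi : X -> Y).
Hypothesis phi_linear : linear phi.

Lemma linear0 : phi 0 = 0.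
Proof.
by have := phi_linear (-1) 0 0; rewrite addr0 !scaleN1r oppr0 addNr.
Qed.

Lemma linear_subZ a x y : phi (x - a *: y) = phi x - a *: phi y.
Proof. by rewrite [x - _]addrC -(scaleNr a y) phi_linear scaleNr addrC. Qed.

Lemma submodules_preimage N : submodules Y N -> submodules X (phi @^-1` N).
Proof.
move=> sN; apply/submodulesP; rewrite /preimage/=; split.
  by rewrite linear0; exact: submod0.
by move=> a x y Nx Ny; rewrite phi_linear; exact: submod_lin.
Qed.

(** The submodule [K + phi(P)], described by congruences modulo [K]: this is the
    form in which simple steps are stated. *)
Definition add_image (K : set Y) (P : set X) : set Y :=
  [set y | exists2 p, P p & K (y - phi p)].

Lemma submodules_add_image K P :
  submodules Y K -> submodules X P -> submodules Y (add_image K P).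
Proof.
move=> sK sP; apply/submodulesP; split.
  by exists 0; [|rewrite linear0 subrr]; exact: submod0.
move=> a x y [p Pp Kx] [q Pq Ky]; exists (a *: p + q); first exact: submod_lin.
by rewrite phi_linear opprD addrACA -scalerBr; exact: submod_lin.
Qed.

Lemma sub_add_image K P : submodules X P -> K `<=` add_image K P.
Proof.
by move=> sP y Ky; exists 0; [exact: submod0|rewrite linear0 subr0].
Qed.

End LinearMaps.

(** * Modules with a composition series *)

Section FiniteLength.
Variables (R : pzRingType) (X : lmodType R).
Implicit Types (N P Q K : set X) (x y : X).

(** The quotient [P / N] is simple or zero.  Allowing zero makes the preimage
    and the image of a step under a linear map steps again. *)
Definition simple_step N P :=
  [/\ submodules X N, submodules X P, N `<=` P &
    forall x y, P x -> ~ N x -> P y -> exists r, N (y - r *: x)].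

(** The interval between two submodules is tracked, rather than a quotient
    module, so that no quotient has to be formed. *)
Inductive finite_length N : set X -> Prop :=
| finite_length_refl : submodules X N -> finite_length N N
| finite_length_step P Q :
    finite_length N P -> simple_step P Q -> finite_length N Q.

Lemma finite_length_sub N P :
  finite_length N P -> [/\ submodules X N, submodules X P & N `<=` P].
Proof.
elim=> [sN|P' Q _ [sN _ NP] [sP sQ PQ _]]; split=> //.
exact: subset_trans PQ.
Qed.

Lemma simple_step_finite_length N P : simple_step N P -> finite_length N P.
Proof.
move=> NP; apply: finite_length_step (NP).
by apply: finite_length_refl; case: NP.
Qed.

Lemma finite_length_trans N P Q :
  finite_length N P -> finite_length P Q -> finite_length N Q.
Proof. by move=> NP; elim=> [_ //|P1 P2 _ NP1]; exact: finite_length_step. Qed.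

(** The rank of [N] is the number of steps of the series that [N] meets.  If [N]
    is contained in [N'] and meets the same steps, then [N = N']: an element y
    of [N'] in the upper end of a step differs from a multiple of an element of
    [N] by an element of [N'] in the lower end, so that, going up the series,
    the two have the same intersection with each term. *)
Lemma finite_length_rank P Q : finite_length P Q ->
  exists k (f : set X -> nat), (forall N, (f N <= k)%N) /\
    forall N N', submodules X N -> submodules X N' -> P `<=` N -> N' `<=` Q ->
      N `<` N' -> (f N < f N')%N.
Proof.
elim=> [sP|P' Q' PP' [k [f [fk fP]]] [sP' sQ' P'Q' simple]].
  exists 0%N, (fun=> 0%N); split=> // N N' _ _ PN N'P [_]; case.
  exact: subset_trans PN.
have [sP _ subPP'] := finite_length_sub PP'.
pose new N := exists2 x, (N `&` Q') x & ~ P' x.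
exists k.+1, (fun N => f (N `&` P') + `[< new N >])%N; split=> [N|].
  by rewrite -addn1 leq_add// leq_b1.
move=> N N' sN sN' PN N'Q [NN' N'N].
have newNN' : (`[< new N >] <= `[< new N' >])%N.
  case: (asboolP (new N)) => // -[x [Nx Qx] P'x].
  by rewrite (_ : `[< new N' >])//; apply/asboolP; exists x => //; split; auto.
have NN'P' : N `&` P' `<=` N' `&` P' by apply: setSI.
case: (pselect (N' `&` P' `<=` N `&` P')) => [N'NP'|nN'NP'].
  have eqNN' : N `&` P' = N' `&` P' by apply/seteqP.
  have [y [N'y Ny]] := nonsubset N'N.
  (* The intersections with the lower end agree, so the last step decides: [N']
     meets it and [N] does not. *)
  rewrite eqNN' ltn_add2l (_ : `[< new N' >])/=; last first.
    apply/asboolP; exists y; first by split=> //; exact: N'Q.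
    by move=> P'y; apply: Ny; have [] : (N `&` P') y by rewrite eqNN'.
  rewrite (_ : `[< new N >] = false)//; apply/asboolP => -[x [Nx Qx] P'x].
  have [r P'yrx] := simple x y Qx P'x (N'Q _ N'y).
  have [Nyrx _] : (N `&` P') (y - r *: x).
    rewrite eqNN'; split=> //; apply: submodB => //.
    by apply: submodZ => //; exact: NN'.
  by apply: Ny; rewrite -(subrK (r *: x) y); apply: submodD => //;
    exact: submodZ.
rewrite -addSn leq_add//; apply: fP => //; try exact: submodulesI.
by rewrite subsetI.
Qed.

(** The rank of a strictly descending sequence would descend forever. *)
Lemma finite_length_dcc P Q : finite_length P Q ->
  dcc [set N | [/\ submodules X N, P `<=` N & N `<=` Q]].
Proof.
move=> /finite_length_rank[k [f [fk fP]]] [N NP].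
have fN n : (f (N n) + n <= f (N 0))%N.
  elim: n => [|n]; first by rewrite addn0.
  rewrite addnS; apply: leq_trans; rewrite ltn_add2r.
  have [[sn _ NQ] NN] := NP n; have [[sSn PN _] _] := NP n.+1.
  exact: fP.
have := leq_trans (fN k.+1) (fk _).
by rewrite addnS ltnNge leq_addl.
Qed.

Lemma add_line N x : submodules X N ->
  let L := [set y | exists r, N (y - r *: x)] in
  [/\ submodules X L, N `<=` L & L x].
Proof.
move=> sN; split.
- apply/submodulesP; split; first by exists 0; rewrite scale0r subr0;
    exact: submod0.
  move=> a y z [r Nr] [s Ns]; exists (a * r + s).
  by rewrite scalerDl opprD addrACA -scalerA -scalerBr; exact: submod_lin.
- by move=> y Ny; exists 0; rewrite scale0r subr0.
- by exists 1; rewrite scale1r subrr; exact: submod0.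
Qed.

(** Minimality of [P] above [L] forces [L + Rx = P] for every x in [P] outside
    [L]. *)
Lemma dcc_cover N L : dcc (above N) -> submodules X L -> N `<=` L ->
  ~ (setT `<=` L) -> exists2 P, simple_step L P & L `<` P.
Proof.
move=> dccN sL NL LT.
pose larger := [set P | submodules X P /\ L `<` P].
have larger_above : larger `<=` above N.
  by move=> P [sP /properW LP]; split=> //; exact: subset_trans LP.
have [|P [sP LP] minP] :=
    no_sequence_extremal (no_sequence_sub larger_above dccN).
  by exists setT; split; [exact: submodulesT|split].
exists P => //; split=> //; first exact: properW.
move=> x y Px Lx Py.
have [sL' LL' L'x] := add_line x sL.
apply: contrapT => nLy; apply: (minP _ (conj sL' _)).
  by split=> // /(_ _ L'x).
split=> [z [r Lz]|/(_ _ Py)//].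
rewrite -(subrK (r *: x) z); apply: submodD => //; last exact: submodZ.
exact: (properW LP).
Qed.

(** A maximal submodule reachable from [N] by a series has no cover. *)
Lemma acc_dcc_finite_length N :
  submodules X N -> acc (above N) -> dcc (above N) -> finite_length N setT.
Proof.
move=> sN accN dccN.
have fl_above : finite_length N `<=` above N.
  by move=> P /finite_length_sub[].
have [|L NL maxL] := no_sequence_extremal (no_sequence_sub fl_above accN).
  by exists N; exact: finite_length_refl.
have [_ sL subNL] := finite_length_sub NL.
case: (pselect (setT `<=` L)) => [TL|nTL].
  by rewrite (_ : setT = L)//; apply/seteqP.
have [P LP ltLP] := dcc_cover dccN sL subNL nTL.
by case: (maxL P) => //; exact: finite_length_step LP.
Qed.

End FiniteLength.

(** * Composition series and linear maps *)

Section Transport.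
Variables (R : pzRingType) (X Y : lmodType R) (phi : X -> Y).
Hypothesis phi_linear : linear phi.

(** Intersecting with [K] lets the preimages under several maps be chained into
    one series; this is how the annihilator of a finitely generated module is
    reached. *)
Lemma finite_length_preimage K N P : submodules X K -> finite_length N P ->
  finite_length (K `&` phi @^-1` N) (K `&` phi @^-1` P).
Proof.
move=> sK; elim=> [sN|P' Q _ NP' [sP' sQ P'Q simple]].
  by apply: finite_length_refl; apply: submodulesI => //;
    exact: submodules_preimage.
apply: finite_length_step NP' _; split.
- by apply: submodulesI => //; exact: submodules_preimage.
- by apply: submodulesI => //; exact: submodules_preimage.
- by apply: setIS => x; exact: P'Q.
- move=> x y [Kx Qx] nP'x [Ky Qy]; have [|r P'yx] := simple _ _ Qx _ Qy.
    by move=> P'x; apply: nP'x.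
  exists r; split; first by apply: submodB => //; exact: submodZ.
  by rewrite /preimage/= linear_subZ.
Qed.

(** Adding [K] lets the images under several maps be chained into one series,
    which climbs through a finitely generated module one generator at a time. *)
Lemma finite_length_add_image K N P : submodules Y K -> finite_length N P ->
  finite_length (add_image phi K N) (add_image phi K P).
Proof.
move=> sK; elim=> [sN|P' Q _ NP' [sP' sQ P'Q simple]].
  by apply: finite_length_refl; exact: submodules_add_image.
have sKP' : submodules Y (add_image phi K P') by exact: submodules_add_image.
apply: finite_length_step NP' _; split=> //; first exact: submodules_add_image.
  by move=> y [p P'p Ky]; exists p => //; exact: P'Q.
move=> x y [p Qp Kx] nx [q Qq Ky].
have [|r P'r] := simple p q Qp _ Qq; first by move=> P'p; apply: nx; exists p.
exists r, (q - r *: p) => //.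
rewrite (linear_subZ phi_linear).
have -> : y - r *: x - (phi q - r *: phi p) = y - phi q - r *: (x - phi p).
  by rewrite scalerBr !opprB !addrA addrAC (addrAC y) [RHS]addrAC.
by apply: submodB => //; exact: submodZ.
Qed.

End Transport.

(** * Vector spaces with the descending chain condition *)

Section VectorSpaces.
Variables (R : pzRingType) (X : lmodType R).

(** Zorn's lemma is applied to the sets whose union with [W], rather than
    themselves, is a submodule without x: then the union of the empty chain,
    which is empty, qualifies as well. *)
Lemma submodule_maximal_avoiding (W : set X) x :
  submodules X W -> ~ W x ->
  exists H, [/\ above W H, ~ H x &
    forall y, ~ H y -> exists r, H (x - r *: y)].
Proof.
move=> sW Wx.
pose avoiding := [set A | submodules X (W `|` A) /\ ~ (W `|` A) x].
have [F avF totF|A [[sA Ax] maxA]] := @Zorn_bigcup _ avoiding.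
  split; last first.
    by case=> [//|[B /avF[_ nBx] Bx]]; apply: nBx; right.
  apply/submodulesP; split; first by left; exact: submod0.
  have one_is_enough B a u v : F B -> (W `|` B) u -> (W `|` B) v ->
      (W `|` \bigcup_(B in F) B) (a *: u + v).
    move=> FB Bu Bv; have [sB _] := avF _ FB.
    by case: (submod_lin a sB Bu Bv) => ?; [left|right; exists B].
  move=> a u v [Wu|[B FB Bu]] [Wv|[C FC Cv]].
  - by left; exact: submod_lin.
  - by apply: (one_is_enough C) => //; [left|right].
  - by apply: (one_is_enough B) => //; [right|left].
  - have [BC|CB] := totF _ _ FB FC.
      by apply: (one_is_enough C) => //; right=> //; apply: BC.
    by apply: (one_is_enough B) => //; right=> //; apply: CB.
exists (W `|` A); split=> [|//|].
  by split; [exact: sA|exact: subsetUl].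
move=> y nAy; apply: contrapT => nLx.
have [sL AL Ly] := add_line y sA.
have WL : W `<=` [set z | exists r, (W `|` A) (z - r *: y)].
  by move=> z Wz; apply: AL; left.
apply: (maxA [set z | exists r, (W `|` A) (z - r *: y)]).
- split=> [z Az|LA]; first by apply: AL; right.
  by apply: nAy; right; exact: LA.
- by rewrite /avoiding/mkset (setUidr WL).
Qed.

(** For an ideal [m] of a commutative ring, this says that [m] is maximal or the
    whole ring. *)
Definition inverse_modulo (m : set R) :=
  forall r, ~ m r -> exists s, m (1 - s * r).

(** For a maximal ideal [m] of a commutative ring, [I / W] is a vector space
    over the field [R / m].  A submodule [U] of [I], minimal among those above
    [W] from which a series leads to [I], must be [W]: otherwise it has a
    hyperplane above [W], and [U] over this hyperplane is one more step.  The
    hyperplane is the intersection of [U] with a submodule that is maximal among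
    those avoiding a given x in [U]. *)
Lemma dcc_vector_space_finite_length (m : set R) (W I : set X) :
  inverse_modulo m -> submodules X W -> submodules X I -> W `<=` I ->
  (forall a x, m a -> I x -> W (a *: x)) ->
  dcc (above W) -> finite_length W I.
Proof.
move=> inv_m sW sI WI mIW dccW.
pose cofinite := [set U | above W U /\ finite_length U I].
have cof_above : cofinite `<=` above W by move=> U [].
have [|U [[sU WU] UI] minU] :=
    no_sequence_extremal (no_sequence_sub cof_above dccW).
  by exists I; split; [split|exact: finite_length_refl].
have [_ _ subUI] := finite_length_sub UI.
have [UW|/nonsubset[x [Ux Wx]]] := pselect (U `<=` W).
  by rewrite (_ : W = U)//; apply/seteqP.
have [H [[sH WH] Hx coverH]] := submodule_maximal_avoiding sW Wx.
exfalso; apply: (minU (H `&` U)); last first.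
  by split=> // UH; apply: Hx; have [] := UH x Ux.
split; first by split; [exact: submodulesI|rewrite subsetI].
apply: finite_length_trans UI; apply: simple_step_finite_length.
split=> //; first exact: submodulesI.
move=> y z Uy nHy Uz.
have [|r Hr] := coverH y; first by move=> Hy; apply: nHy.
have [Hz|nHz] := pselect (H z).
  by exists 0; rewrite scale0r subr0.
have [t Ht] := coverH z nHz.
(* The coefficient of z is invertible modulo m, so z is a multiple of x
   modulo H, and x is a multiple of y. *)
have nmt : ~ m t.
  move=> mt; apply: Hx; rewrite -(subrK (t *: z) x); apply: submodD => //.
  by apply: WH; apply: mIW => //; exact: subUI.
have [s mst] := inv_m t nmt.
have Hzsx : H (z - s *: x).
  have -> : z - s *: x = (1 - s * t) *: z - s *: (x - t *: z).
    by rewrite scalerBl scale1r scalerBr scalerA opprB addrA subrK.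
  apply: submodB; [exact: sH| |exact: submodZ].
  by apply: WH; apply: mIW => //; exact: subUI.
exists (s * r); split; last by apply: submodB => //; exact: submodZ.
have -> : z - (s * r) *: y = (z - s *: x) + s *: (x - r *: y).
  by rewrite scalerBr scalerA addrA subrK.
by apply: submodD => //; exact: submodZ.
Qed.

End VectorSpaces.

(** * Artinian rings have a composition series *)

Section ArtinianRings.
Variable R : comNzRingType.
Implicit Types (I J K L m : set R^o) (a x y : R).

Lemma idealM a x J : submodules R^o J -> J x -> J (a * x).
Proof. exact: (@submodZ _ R^o). Qed.

Lemma submodules_colon x J :
  submodules R^o J -> submodules R^o [set r | J (r * x)].
Proof.
move=> sJ; apply: (@submodules_preimage _ R^o R^o ( *%R^~ x)) => // a u v.
by rewrite mulrDl -scalerAl.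
Qed.

(** The annihilator of a generator of a simple module is maximal: minimal
    submodules yield maximal ideals without a further appeal to Zorn's lemma. *)
Lemma cover_inverse_modulo L P y :
  simple_step L P -> P y -> ~ L y -> inverse_modulo [set r | L (r * y)].
Proof.
move=> [sL sP _ simple] Py nLy r nLry.
have [|s Ls] := simple (r * y) y _ nLry Py; first exact: idealM.
by exists s; rewrite /= mulrBl mul1r -mulrA.
Qed.

(** The ideal [J + I K]. *)
Definition mul_add J I K : set R^o :=
  submod_gen (J `|` [set a * x | a in I & x in K]).

Lemma sub_mul_add J I K : J `<=` mul_add J I K.
Proof. by move=> x Jx; apply: sub_submod_gen; left. Qed.

Lemma mul_mul_add J I K a x : I a -> K x -> mul_add J I K (a * x).
Proof. by move=> Ia Kx; apply: sub_submod_gen; right; exists a => //;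
  exists x. Qed.

Lemma mul_add_sub J I K N : submodules R^o N -> J `<=` N ->
  (forall a x, I a -> K x -> N (a * x)) -> mul_add J I K `<=` N.
Proof.
move=> sN JN IKN; apply: submod_gen_sub => //.
by move=> _ [/JN//|[a Ia [x Kx <-]]]; exact: IKN.
Qed.

(** The two minimal choices [I] and [K] described in the introduction; the ideal
    [m] comes from a cover of [(J : x)], hence contains [(J : x)]. *)
Lemma artinian_finite_length J :
  submodules R^o J -> dcc (above J) -> finite_length J setT.
Proof.
move=> sJ dccJ.
have [|I [[sI JI] flI] minI] := no_sequence_extremal
    (@no_sequence_sub _ _ _ [set I | above J I /\ finite_length I setT]
      (fun _ => @proj1 _ _) dccJ).
  exists setT; split; last exact/finite_length_refl/submodulesT.
  by split=> //; exact: submodulesT.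
have I_mul m : inverse_modulo m -> I `<=` mul_add J m I.
  move=> inv_m; set W := mul_add J m I.
  have sW : submodules R^o W by exact: submod_gen_submodule.
  have JW : J `<=` W by exact: sub_mul_add.
  have WI : W `<=` I by apply: mul_add_sub => // a x _; exact: idealM.
  have flW : finite_length W I.
    apply: (dcc_vector_space_finite_length inv_m) => //.
      by move=> a x; exact: mul_mul_add.
    apply: no_sequence_sub dccJ => P [sP WP]; split=> //.
    exact: subset_trans WP.
  apply: contrapT => IW; apply: (minI W) => //.
  by split=> //; exact: finite_length_trans flI.
have [IJ|/nonsubset[i0 [Ii0 nJi0]]] := pselect (I `<=` J).
  by rewrite (_ : J = I)//; apply/seteqP.
exfalso.
pose large := [set K | above J K /\ exists k i, [/\ K k, I i & ~ J (k * i)]].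
have [|K [[sK JK] [x [i [Kx Ii nJxi]]]] minK] := no_sequence_extremal
    (@no_sequence_sub _ _ _ large (fun _ => @proj1 _ _) dccJ).
  exists setT; split; first by split=> //; exact: submodulesT.
  by exists 1, i0; rewrite mul1r.
have nJx : ~ J x by move=> Jx; apply: nJxi; rewrite mulrC; exact: idealM.
pose L := [set r | J (r * x)] : set R^o.
have sL : submodules R^o L by exact: submodules_colon.
have [||P LP [subLP /nonsubset[y [Py nLy]]]] := dcc_cover dccJ sL.
- by move=> j Jj; rewrite /L/= mulrC; exact: idealM.
- by move=> /(_ 1 Logic.I); rewrite /L/= mul1r.
pose m := [set r | L (r * y)] : set R^o.
have sm : submodules R^o m by exact: submodules_colon.
have inv_m : inverse_modulo m by exact: cover_inverse_modulo LP Py nLy.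
have K_mul : K `<=` mul_add J m K.
  have mulK : mul_add J m K `<=` K by apply: mul_add_sub => // a k _;
    exact: idealM.
  apply: contrapT => nKmul; apply: (minK (mul_add J m K)) => //.
  split; first by split; [exact: submod_gen_submodule|exact: sub_mul_add].
  apply: contrapT => small; apply: nJxi.
  rewrite mulrC.
  suff : mul_add J m I `<=` [set r | J (r * x)] by apply; exact: I_mul.
  apply: mul_add_sub; first exact: submodules_colon.
    by move=> j Jj /=; rewrite mulrC; exact: idealM.
  move=> a i' ma Ii' /=; apply: contrapT => nJ; apply: small.
  exists (a * x), i'; split=> //; first exact: mul_mul_add.
  by rewrite mulrAC.
(* By minimality K = Rx + J, as x already witnesses that K is large. *)
have K_line k : K k -> exists r, J (k - r * x).
  have [sKx JKx Kxx] := @add_line _ R^o J x sJ.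
  move=> Kk; apply: contrapT => nk.
  apply: (minK (K `&` [set y | exists r, J (y - r *: (x : R^o))])).
    split; first by split; [exact: submodulesI|rewrite subsetI].
    by exists x, i.
  by split; [exact: subIsetl|move=> /(_ k Kk)[]].
have [a ma Jax] : add_image ( *%R^~ x : R^o -> R^o) J m x.
  have lin_x : linear ( *%R^~ x : R^o -> R^o).
    by move=> a u v; rewrite mulrDl -scalerAl.
  apply: (mul_add_sub _ _ _ (K_mul x Kx)).
  - exact: submodules_add_image.
  - exact: sub_add_image.
  - move=> a k ma /K_line[r Jr]; exists (a * r).
      by rewrite mulrC; exact: idealM.
    by rewrite -mulrA -mulrBr; exact: idealM.
have m1a : m (1 - a).
  rewrite /m/= mulrC; apply: idealM => //.
  by rewrite /L/= mulrBl mul1r.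
apply: nLy; rewrite -[y]mul1r -[1](subrK a).
exact: (submodD sm m1a ma).
Qed.

End ArtinianRings.

(** * Finitely generated modules and their annihilators *)

Section Generators.
Variables (R : comNzRingType) (M : lmodType R).
Implicit Types (s : seq M) (N : set M).

Definition scale_by (g : M) : R^o -> M := fun r => (r : R) *: g.

Lemma linear_scale_by g : linear (scale_by g).
Proof. rewrite /scale_by; by move=> a u v; rewrite scalerDl scalerA. Qed.

Fixpoint span_seq s : set M :=
  if s is g :: s' then add_image (scale_by g) (span_seq s') setT
  else [set 0].

Lemma submodules_span_seq s : submodules M (span_seq s).
Proof.
elim: s => [|g s IHs] /=; first exact: submodules0.
by apply: submodules_add_image => //;
  [exact: linear_scale_by|exact: submodulesT].
Qed.

Lemma span_seq_coef s y :
  span_seq s y -> exists c : nat -> R, y = \sum_(i < size s) c i *: s`_i.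
Proof.
elim: s y => [|g s IHs] y /=; first by move=> ->; exists (fun=> 0);
  rewrite big_ord0.
move=> [r _ /IHs[c yrg]]; exists (fun i => if i is j.+1 then c j else r).
by rewrite big_ord_recl/= -yrg addrC subrK.
Qed.

Lemma span_seq_sum (I : Type) (t : seq I) (c : I -> R) (g : I -> M) :
  span_seq (map g t) (\sum_(i <- t) c i *: g i).
Proof.
elim: t => [|i t IHt] /=; first by rewrite big_nil.
by exists (c i) => //; rewrite big_cons addrC addKr.
Qed.

Lemma finitely_generatedP :
  finitely_generated M <-> exists s, setT `<=` span_seq s.
Proof.
split=> [[n [g gM]]|[s sM]].
  exists (map g (index_enum 'I_n)) => m _.
  by have [c ->] := gM m; exact: span_seq_sum.
exists (size s), (fun i => s`_i) => m.
by have [c ->] := span_seq_coef (sM m Logic.I); exists c.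
Qed.

Lemma finite_length_span_seq N :
  finite_length [set 0] N -> exists s, N `<=` span_seq s.
Proof.
elim=> [_|P Q _ [s Ps] [sP sQ PQ simple]]; first by exists [::].
have [QP|/nonsubset[x [Qx nPx]]] := pselect (Q `<=` P).
  by exists s; exact: subset_trans Ps.
exists (x :: s) => y Qy; have [r Pr] := simple x y Qx nPx Qy.
by exists r => //; exact: Ps.
Qed.

(** Adding the generator g to the span adds a quotient of [R / J], because [J]
    kills g. *)
Lemma span_seq_finite_length (J : set R^o) s :
  finite_length J setT -> (forall (r : R) (m : M), J r -> r *: m = 0) ->
  finite_length [set 0] (span_seq s).
Proof.
move=> flJ J0; elim: s => [|g s IHs].
  exact/finite_length_refl/submodules0.
have [sJ _ _] := finite_length_sub flJ.
apply: finite_length_trans IHs _ => /=.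
have {1}<- : add_image (X := R^o) (scale_by g) (span_seq s) J = span_seq s.
  apply/seteqP; split; last by apply: sub_add_image => //;
    exact: linear_scale_by.
  by move=> y [r Jr]; rewrite /scale_by J0// subr0.
apply: finite_length_add_image => //; first exact: linear_scale_by.
exact: submodules_span_seq.
Qed.

Fixpoint annihilator_seq s : set R^o :=
  if s is g :: s' then
    annihilator_seq s' `&` (scale_by g) @^-1` [set 0]
  else setT.

Lemma submodules_annihilator_seq s : submodules R^o (annihilator_seq s).
Proof.
elim: s => [|g s IHs] /=; first exact: submodulesT.
apply: submodulesI => //; apply: submodules_preimage;
  first exact: linear_scale_by.
exact: submodules0.
Qed.

(** An ideal modulo those of its elements that kill one more generator g embeds
    in [M] by r |-> r g, so it inherits a series from that of [M]. *)
Lemma annihilator_seq_finite_length s :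
  finite_length [set (0 : M)] setT -> finite_length (annihilator_seq s) setT.
Proof.
move=> flM; elim: s => [|g s IHs] /=.
  exact/finite_length_refl/submodulesT.
apply: finite_length_trans IHs.
rewrite -[X in finite_length _ X]setIT -(preimage_setT (scale_by g)).
apply: finite_length_preimage => //; first exact: linear_scale_by.
exact: submodules_annihilator_seq.
Qed.

Lemma annihilator_seqE s :
  setT `<=` span_seq s -> annihilator_seq s = [set r | r \in annihilator M].
Proof.
move=> sM; apply/seteqP; split=> r /=; last first.
  by move=> /asboolP r0; elim: s {sM} => [//|g s IHs] /=; split=> //; exact: r0.
move=> rs; apply/asboolP => m.
have : span_seq s m by exact: sM.
elim: s rs m {sM} => [|g s IHs] /= => [_ m ->|[/IHs rs]].
  by rewrite scaler0.
rewrite /preimage/scale_by/= => rg m [a _ /rs].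
by rewrite scalerBr scalerA mulrC -scalerA rg scaler0 subr0.
Qed.

End Generators.

(** * Ideals of the quotient by the annihilator *)

Section AnnihilatorQuotient.
Variables (R : comNzRingType) (M : lmodType R).
Local Open Scope quotient_scope.
Local Notation A := (ann_quot M).
Local Notation pi := (\pi_A : R -> A).
Local Notation J := ([set r | r \in annihilator M] : set R^o).

Lemma pi_ann_quot0 : pi 0 = 0.
Proof. by apply: (addrI (pi 0)); rewrite -pi_ann_quot_add !addr0. Qed.

Lemma submodules_pi_preimage (N : set A^o) :
  submodules A^o N -> above J (pi @^-1` N).
Proof.
move=> sN; split.
  apply/submodulesP; split; first by rewrite /preimage/= pi_ann_quot0;
    exact: (submod0 sN).
  move=> a x y Nx Ny; rewrite /preimage/= pi_ann_quot_add pi_ann_quot_mul.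
  exact: (submod_lin (X := A^o) _ sN).
move=> r /= rJ; rewrite /preimage/= (_ : pi r = 0); first exact: (submod0 sN).
by apply/eqP; rewrite -pi_ann_quot0 ann_quot_eqE subr0.
Qed.

(** An ideal above the annihilator is a union of cosets, so it can be tested on
    any representative. *)
Lemma above_repr (I : set R^o) r : above J I -> I (repr (pi r)) <-> I r.
Proof.
move=> [sI JI].
have Ir : I (r - repr (pi r)).
  by apply: JI => /=; rewrite -ann_quot_eqE reprK.
split=> [Ip|Ipr]; first by rewrite -[r](subrK (repr (pi r)));
  exact: (submodD sI).
by rewrite -[repr _](subKr r); exact: (submodB sI).
Qed.

Lemma submodules_repr_preimage (I : set R^o) :
  above J I -> submodules A^o ((fun a : A => repr a) @^-1` I).
Proof.
move=> JI; have [sI _] := JI; apply/submodulesP; split; rewrite /preimage/=.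
  by rewrite -pi_ann_quot0; apply/above_repr => //; exact: (submod0 sI).
move=> a x y Ix Iy.
rewrite [a *: x + y](_ : _ = pi (repr a * repr x + repr y)).
  by apply/above_repr => //; exact: (submod_lin (X := R^o) _ sI).
by rewrite pi_ann_quot_add pi_ann_quot_mul !reprK.
Qed.

(** Taking preimages along the projection identifies the ideals of the quotient
    with the ideals of [R] above the annihilator. *)
Lemma artinian_ann_quotP : artinian_ring A <-> dcc (above J).
Proof.
split=> [artA [N NP]|dccJ N sN Ndec].
  pose N' n : set A^o := (fun a : A => repr a) @^-1` N n.
  have [n|n|n stat] := artA N'.
  - by apply: submodules_repr_preimage; have [] := NP n.
  - by move=> a; have [_ [sub _]] := NP n; exact: sub.
  - have [JNn [_ /nonsubset[x [Nx nNx]]]] := NP n.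
    have [JNSn _] := NP n.+1; apply: nNx.
    apply/(above_repr _ JNSn).
    change (N' n.+1 (pi x)); rewrite (stat _ (leqnSn n)).
    exact/(above_repr _ JNn).
pose terms := range (fun n => pi @^-1` N n : set R^o).
have terms_above : terms `<=` above J.
  by move=> _ [n _ <-]; exact: submodules_pi_preimage.
have [|_ [n _ <-] minN] :=
    no_sequence_extremal (no_sequence_sub terms_above dccJ).
  by exists (pi @^-1` N 0%N), 0%N.
exists n => m nm.
have NmNn : N m `<=` N n.
  elim: m nm => [|m IHm]; first by rewrite leqn0 => /eqP ->.
  rewrite leq_eqVlt => /predU1P[->//|/IHm]; exact: subset_trans.
apply/seteqP; split=> //; apply: contrapT => /nonsubset[x [Nx nNx]].
apply: (minN (pi @^-1` N m)); first by exists m.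
split; first by move=> r; exact: NmNn.
by move=> /(_ (repr x)); rewrite /preimage/= reprK => /(_ Nx).
Qed.

End AnnihilatorQuotient.

(** * Length *)

Section Length.
Variables (R : pzRingType) (M : lmodType R).

Lemma module_length_finiteP : (module_length M < +oo)%E <->
  exists k, forall n, has_submodule_chain M n -> (n <= k)%N.
Proof.
have [ub lub] := module_length_isLub M; split=> [fin|[k chain_k]].
  have ub0 := ub _ (chain_lengths0 M).
  case E : (module_length M) fin ub0 ub => [y||] // _ _ ub.
  exists `|y|%N => n Mn.
  have := ub _ (ex_intro2 _ _ n Mn erefl); rewrite lee_fin => ny.
  by rewrite -lez_nat gez0_abs//; exact: le_trans ny.
apply: (@le_lt_trans _ _ (k%:Z)%:E); last exact: ltry.
by apply: lub => _ [n /chain_k nk <-]; rewrite lee_fin lez_nat.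
Qed.

Lemma bounded_length_acc k :
  (forall n, has_submodule_chain M n -> (n <= k)%N) -> acc (submodules M).
Proof.
move=> chain_k [N NP];
  suff /chain_k : has_submodule_chain M k.+1 by rewrite ltnn.
by exists N; split=> i _; have [] := NP i.
Qed.

Lemma bounded_length_dcc k :
  (forall n, has_submodule_chain M n -> (n <= k)%N) -> dcc (submodules M).
Proof.
move=> chain_k [N NP];
  suff /chain_k : has_submodule_chain M k.+1 by rewrite ltnn.
exists (fun i => N (k.+1 - i)%N); split=> i ik;
  first by have [] := NP (k.+1 - i)%N.
by rewrite subSS subSn//; have [] := NP (k - i)%N.
Qed.

Lemma above0 : above [set (0 : M)] = submodules M.
Proof.
apply/seteqP; split=> [N []//|N sN]; split=> // _ ->; exact: submod0.
Qed.

Lemma finite_length_bounded : finite_length [set (0 : M)] setT ->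
  exists k, forall n, has_submodule_chain M n -> (n <= k)%N.
Proof.
move=> /finite_length_rank[k [f [fk fP]]]; exists k => n [N [sN ltN]].
suff iN i : (i <= n)%N -> (i <= f (N i))%N by exact: leq_trans (iN n _) (fk _).
elim: i => [//|i IHi] ilen; apply: leq_ltn_trans (IHi (ltnW ilen)) _.
apply: fP => //; [exact/sN/ltnW|exact: sN| |exact: ltN].
by move=> _ ->; apply: submod0; exact/sN/ltnW.
Qed.

Lemma module_length_finite_length :
  (module_length M < +oo)%E <-> finite_length [set (0 : M)] setT.
Proof.
split=> [/module_length_finiteP[k chain_k]|/finite_length_bounded].
  apply: acc_dcc_finite_length; first exact: submodules0.
    by rewrite above0; exact: bounded_length_acc chain_k.
  by rewrite above0; exact: bounded_length_dcc chain_k.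
by move=> ?; exact/module_length_finiteP.
Qed.

End Length.

(** * Intermediate algebras of the idealization *)

Section Idealization.
Variables (R : comNzRingType) (M : lmodType R).
Implicit Types (N : set M) (A : set (idealization M)).

Definition extension N : set (idealization M) := [set x | N x.2].
Definition nilpotent_part A : set M := [set m | A (0, m)].

Lemma intermediate_extension N :
  submodules M N -> intermediate_algebras (idealization M) (extension N).
Proof.
move=> sN; split=> [|a u v|u v]; rewrite ?inE /extension/=.
- exact: submod0.
- by move=> Nu Nv; exact: submod_lin.
- by move=> Nu Nv; apply: submodD => //; exact: submodZ.
Qed.

Lemma submodules_nilpotent_part A :
  intermediate_algebras (idealization M) A -> submodules M (nilpotent_part A).
Proof.
move=> [A1 Alin _]; apply/submodulesP; split; rewrite /nilpotent_part/=.
  apply/set_mem; rewrite (_ : (0, 0) = (-1) *: 1 + 1 :> idealization M).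
    exact: Alin.
  by rewrite scaleN1r addNr.
move=> a x y /mem_set Ax /mem_set Ay; apply/set_mem.
rewrite (_ : (0, _) = a *: ((0, x) : idealization M) + (0, y));
  first exact: Alin.
by congr pair; rewrite /= mulr0 addr0.
Qed.

(** Subtracting a multiple of the unit changes the first component at will. *)
Lemma nilpotent_partK A : intermediate_algebras (idealization M) A ->
  extension (nilpotent_part A) = A.
Proof.
move=> [A1 Alin _].
have shift r a m : A (r, m) -> A (r + a, m).
  move=> /mem_set Arm; apply/set_mem.
  rewrite (_ : (r + a, m) = a *: (1 : idealization M) + (r, m));
    first exact: Alin.
  by congr pair; rewrite /= ?mulr1 ?scaler0 ?add0r// addrC.
apply/seteqP; split=> -[r m]; rewrite /extension/nilpotent_part/=.
  by move=> /(shift _ r); rewrite add0r.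
by move=> /(shift _ (- r)); rewrite subrr.
Qed.

Lemma extensionS N N' : N `<=` N' <-> extension N `<=` extension N'.
Proof. by split=> [NN' x|NN' m Nm]; [exact: NN'|exact: (NN' (0, m))]. Qed.

Lemma extensionK N : nilpotent_part (extension N) = N.
Proof. by []. Qed.

(** The extensions of the terms would form an infinite chain of intermediate
    algebras. *)
Lemma FCP_no_infinite_chain (N : nat -> set M) :
  FCP (idealization M) -> (forall n, submodules M (N n)) -> injective N ->
  ~ total_on (range N) subset.
Proof.
move=> fcp sN injN totN.
have : finite_set (range (extension \o N)).
  apply: fcp => [_ [n _ <-]|_ _ [i _ <-] [j _ <-]] /=.
    exact: intermediate_extension.
  by rewrite -!extensionS; apply: totN; [exists i|exists j].
move=> /(@finite_preimage _ _ _ (extension \o N)) fin; apply: infinite_nat.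
apply: sub_finite_set (fin _); first by move=> n _; exists n.
move=> i j _ _ /= /(congr1 nilpotent_part); rewrite !extensionK; exact: injN.
Qed.

Lemma FCP_acc : FCP (idealization M) -> acc (submodules M).
Proof.
move=> fcp [N NP].
have mono : {homo N : i j / (i < j)%N >-> i `<` j}.
  apply: homo_ltn => [x y z [yx nxy] [xz nzx]|i]; last by have [] := NP i.
  by split; [exact: subset_trans xz|move=> zy; apply: nxy;
    exact: subset_trans zy].
apply: (FCP_no_infinite_chain fcp (N := N)).
- by move=> n; have [] := NP n.
- move=> i j Nij; case: (ltngtP i j) => // /mono; rewrite Nij => /properxx//.
- move=> _ _ [i _ <-] [j _ <-].
  by case: (ltngtP i j) => [/mono/properW|/mono/properW|->]; [left|right|left].
Qed.

Lemma FCP_dcc : FCP (idealization M) -> dcc (submodules M).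
Proof.
move=> fcp [N NP].
have mono i j : (i < j)%N -> N j `<` N i.
  move: i j; apply: (@homo_ltn _ N (fun P Q => Q `<` P)) => [y x z [yx nxy]
    [zy nyz]|i].
    by split; [exact: subset_trans yx|move=> xz; apply: nxy;
      exact: subset_trans zy].
  by have [] := NP i.
apply: (FCP_no_infinite_chain fcp (N := N)).
- by move=> n; have [] := NP n.
- move=> i j Nij; case: (ltngtP i j) => // /mono; rewrite Nij => /properxx//.
- move=> _ _ [i _ <-] [j _ <-].
  by case: (ltngtP i j) => [/mono/properW|/mono/properW|->]; [right|left|left].
Qed.

(** The rank of the nilpotent part takes finitely many values and separates the
    members of a chain. *)
Lemma finite_length_FCP :
  finite_length [set (0 : M)] setT -> FCP (idealization M).
Proof.
move=> /finite_length_rank[k [f [fk fP]]] C CA totC.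
have rank_lt A B : C A -> C B -> A `<=` B -> ~ B `<=` A ->
    (f (nilpotent_part A) < f (nilpotent_part B))%N.
  move=> CCA CCB AB BA; have [iA iB] := (CA _ CCA, CA _ CCB).
  have sA := submodules_nilpotent_part iA.
  apply: fP => //; first exact: submodules_nilpotent_part.
    by move=> _ ->; exact: submod0.
  by split; rewrite extensionS !nilpotent_partK.
pose h i := xget set0 [set A | C A /\ f (nilpotent_part A) = i].
apply: sub_finite_set (finite_image h (finite_II k.+1)) => A CCA.
exists (f (nilpotent_part A)); first by rewrite /= ltnS.
rewrite /h; case: xgetP => [B _ [CCB fBA]|/(_ A)[]//].
have [BA|AB] := totC _ _ CCB CCA.
  apply/seteqP; split=> //; apply: contrapT => nAB.
  by have := rank_lt _ _ CCB CCA BA nAB; rewrite fBA ltnn.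
apply/seteqP; split=> //; apply: contrapT => nBA.
by have := rank_lt _ _ CCA CCB AB nBA; rewrite fBA ltnn.
Qed.

End Idealization.

Theorem proposition5p2 (R : comNzRingType) (M : lmodType R) :
  (FCP (idealization M) <-> (module_length M < +oo)%E) /\
  ((module_length M < +oo)%E <->
     artinian_ring (ann_quot M) /\ finitely_generated M).
Proof.
rewrite module_length_finite_length; split; split.
- move=> fcp; apply: acc_dcc_finite_length; first exact: submodules0.
    by rewrite above0; exact: FCP_acc.
  by rewrite above0; exact: FCP_dcc.
- exact: finite_length_FCP.
- move=> flM; have [s sM] := finite_length_span_seq flM.
  split; last by apply/finitely_generatedP; exists s.
  apply/artinian_ann_quotP; rewrite -(annihilator_seqE sM).
  apply: no_sequence_sub (finite_length_dcc (annihilator_seq_finite_length s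
    flM)).
  by move=> N [sN JN]; split.
- move=> [/artinian_ann_quotP dccJ /finitely_generatedP[s sM]].
  have sJ : submodules R^o [set r | r \in annihilator M].
    apply/submodulesP; split=> [|a x y Jx Jy]; first exact: rpred0.
    by apply: rpredD => //; exact: annihilatorMl.
  rewrite (_ : setT = span_seq s); last by apply/seteqP; split.
  apply: span_seq_finite_length (artinian_finite_length sJ dccJ) _.
  by move=> r m /asboolP.
Qed.
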